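(* Let $S_t$ denote the number of sample actions taken by the Geometric Resampling procedure with cap $M$ (terminated early as soon as possible) in round $t$. Then $\mathbb E[S_t]\le d$ for every $t$. Also, for any $\delta>0$, $$\sum_{t=1}^TS_t\le(e-1)dT+M\log\frac1\delta$$ holds with probability at least $1-\delta$.
   Context: Let $\mathcal S\subseteq\{0,1\}^d$ be a nonempty finite set and $T,M\ge1$ integers. A learner using a randomized algorithm interacts with an environment over rounds $t=1,\dots,T$. $\mathcal F_{t-1}$ denotes the sigma-algebra generated by the whole history of interaction (including all of the learner's random draws) up to the end of round $t-1$. In round $t$ the learner plays $\boldsymbol V_t\in\mathcal S$ with $\mathbb P[\boldsymbol V_t=\boldsymbol v\mid\mathcal F_{t-1}]=p_t(\boldsymbol v)$, where $\boldsymbol{p}_t$ is an $\mathcal F_{t-1}$-measurable probability distribution over $\mathcal S$. **Geometric Resampling with cap $M$.** In round $t$, after drawing $\boldsymbol V_t\sim\boldsymbol p_t$, draw copies $\boldsymbol V'_t(1),\boldsymbol V_t'(2),\dots,\boldsymbol V_t'(M)$ from $\boldsymbol p_t$, which given $\mathcal F_{t-1}$ are independent of each other and of $\boldsymbol V_t$. For $i=1,\dots,d$ let $K_{t,i}=\min\big(\{k\in\{1,\dots,M\}:V'_{t,i}(k)=1\}\cup\{M\}\big)$. Only the values $K_{t,i}$ with $V_{t,i}=1$ are needed, so the sampling is terminated once for every $i$ with $V_{t,i}=1$ there has been a copy with $V'_{t,i}(k)=1$, or after $M$ samples. Thus the number of sample actions is $S_t=\max_{j=1,\dots,d}V_{t,j}K_{t,j}$.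 *)

(* Defs.v *)
From mathcomp Require Import all_boot all_order all_algebra.
From mathcomp Require Import all_classical all_reals all_analysis.

Set Implicit Arguments.
Unset Strict Implicit.
Unset Printing Implicit Defensive.

Import Order.TTheory GRing.Theory Num.Theory.

Local Open Scope classical_set_scope.
Local Open Scope ring_scope.

(* q is a version of the conditional probability of the event B given the
   sub-sigma-algebra G. *)
Definition cond_prob_version (d : measure_display) (Omega : measurableType d)
    (R : realType) (P : probability Omega R) (G : set_system Omega)
    (B : set Omega) (q : Omega -> R) : Prop :=
  [/\ forall C : set R, measurable C -> G (q @^-1` C),
      P.-integrable [set: Omega] (fun w => (q w)%:E)
    & forall A : set Omega, G A -> P (A `&` B) = (\int[P]_(w in A) (q w)%:E)%E].

(* Conditional probabilities are only determined almost surely, hence the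
   quantification over their versions.  Taking some of the C i to be the whole
   space gives the product rule for every subfamily. *)
Definition cond_independent (d d' : measure_display) (Omega : measurableType d)
    (E : measurableType d') (R : realType) (P : probability Omega R)
    (G : set_system Omega) (I : finType) (X : I -> Omega -> E) : Prop :=
  forall C : I -> set E, (forall i, measurable (C i)) ->
  forall q : I -> Omega -> R,
    (forall i, cond_prob_version P G (X i @^-1` C i) (q i)) ->
    cond_prob_version P G (\bigcap_i (X i @^-1` C i))
      (fun w => \prod_i q i w).

(* The points of {0,1}^d are the boolean d-tuples. *)
Definition distribution_on (R : realType) (d : nat) (S : {set d.-tuple bool})
    (p : d.-tuple bool -> R) : Prop :=
  [/\ forall v, 0 <= p v, forall v, v \notin S -> p v = 0 & \sum_v p v = 1].

(* The sigma-algebra of everything observed or drawn up to the end of round t,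
   rounds being numbered from 1: V s is the action of round s, V' s k is its
   k-th resampled copy, and Y s is all the rest of the interaction in round s
   (moves of the environment, feedback, any further randomness of the learner);
   Y 0 is what is available before the first round. *)
Definition history (d0 dE : measure_display) (Omega : measurableType d0)
    (E : nat -> measurableType dE) (d M : nat) (Y : forall s, Omega -> E s)
    (V : nat -> Omega -> d.-tuple bool)
    (V' : nat -> nat -> Omega -> d.-tuple bool) (t : nat) : set_system Omega :=
  <<s \bigcup_(s in [set s | (s <= t)%N])
        preimage_set_system [set: Omega] (Y s) measurable
      `|` \bigcup_(s in [set s | (1 <= s <= t)%N])
        (preimage_set_system [set: Omega] (V s) measurable
         `|` \bigcup_(k in [set k | (1 <= k <= M)%N])
           preimage_set_system [set: Omega] (V' s k) measurable) >>.

(* K_i = min ({k in {1, ..., M} : v' k i = 1} U {M}): the cap M is the value of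
   the minimum over the empty range. *)
Definition resampling_index (d M : nat) (v' : nat -> d.-tuple bool)
    (i : 'I_d) : nat :=
  \big[minn/M]_(1 <= k < M.+1 | tnth (v' k) i) k.

Definition sample_actions (d M : nat) (v : d.-tuple bool)
    (v' : nat -> d.-tuple bool) : nat :=
  (\max_(j < d) (tnth v j * resampling_index M v' j))%N.

(* Main.v *)
Require Import Defs.
From mathcomp Require Import all_boot all_order all_algebra.
From mathcomp Require Import all_classical all_reals all_analysis.
From mathcomp Require Import measurable_realfun zify ring lra.

Import Order.TTheory GRing.Theory Num.Theory.

Local Open Scope classical_set_scope.
Local Open Scope ring_scope.

(* Coordinate j contributes V_j K_j <= sum_(m < M) 1[V_j = 1 and the copies
   1, ..., m all vanish at j], whose conditional expectation given the past is
   sum_(m < M) p_j (1 - p_j)^m = 1 - (1 - p_j)^M <= 1, where p_j is the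
   conditional probability of V_j = 1; hence E[S_t | F_(t-1)] <= d.
   Since 0 <= S_t / M <= 1 and exp x <= 1 + (e - 1) x on [0, 1], we get
   E[exp (S_t / M) | F_(t-1)] <= exp ((e - 1) d / M), so that
   E[exp (sum_t S_t / M)] <= exp ((e - 1) d T / M), and the tail bound is
   Markov's inequality. *)

(** * Measurability of finite-valued and integer-valued maps *)

(** The preimage is a finite union, over the families in [B], of finite intersections of fibres.
    Measurable fibres are therefore enough, and [V] needs no sigma-algebra of its own. *)
Lemma measurable_finite_family (d : measure_display) (T : measurableType d)
    (I V : finType) (X : I -> T -> V) (B : set {ffun I -> V}) :
  (forall i v, measurable (X i @^-1` [set v])) ->
  measurable ((fun w => [ffun i => X i w]) @^-1` B).
Proof.
move=> mX.
have -> : (fun w => [ffun i => X i w]) @^-1` B =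
    \bigcup_(f in B) \bigcap_(i in [set: I]) (X i @^-1` [set f i]).
  apply/seteqP; split=> [w /= Bw | w /= [f Bf fw]].
    by exists [ffun i => X i w] => // i _ /=; rewrite ffunE.
  suff -> : [ffun i => X i w] = f by [].
  by apply/ffunP => i; rewrite ffunE; exact: fw.
apply: fin_bigcup_measurable => [|f _]; first exact: finite_finset.
by apply: fin_bigcap_measurable => [|i _]; [exact: finite_finset | exact: mX].
Qed.

(** A singleton is a finite intersection of coordinate cylinders, and any set of tuples is a finite
    union of singletons. *)
Lemma measurable_bool_tuple (d : nat) (B : set (d.-tuple bool)) : measurable B.
Proof.
have -> : B = \bigcup_(v in B) \bigcap_(j in [set: 'I_d])
    ((fun u : d.-tuple bool => tnth u j) @^-1` [set tnth v j]).
  apply/seteqP; split=> [v Bv | v /= [u Bu uv]]; first by exists v.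
  suff -> : v = u by [].
  by apply: eq_from_tnth => j; exact: uv.
apply: fin_bigcup_measurable => [|v _]; first exact: finite_finset.
apply: fin_bigcap_measurable => [|j _]; first exact: finite_finset.
by rewrite -[X in measurable X]setTI; apply: measurable_tnth.
Qed.

Lemma measurable_comp_nat (disp : measure_display) (T : measurableType disp)
    (R : realType) (N : T -> nat) (h : nat -> R) (D : set T) :
  (forall B, measurable (N @^-1` B)) ->
  measurable_fun D (fun w => h (N w)).
Proof. by move=> mN mD Y _; apply: measurableI => //; exact: (mN (h @^-1` Y)). Qed.

(** Induction on [t], splitting according to the value [h] of the earlier sum. Only the terms 1 to
    [t] are assumed measurable, so that the ambient sigma-algebra may be the history up to round
    [t]. *)
Lemma measurable_sum_nat (disp : measure_display) (T : measurableType disp)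
    (N : nat -> T -> nat) (t : nat) (B : set nat) :
  (forall s C, (1 <= s <= t)%N -> measurable (N s @^-1` C)) ->
  measurable ((fun w => \sum_(1 <= s < t.+1) N s w)%N @^-1` B).
Proof.
elim: t B => [|t IHt] B mN.
  rewrite (_ : (fun w => _) = cst 0%N); last by apply/funext => w; rewrite big_geq.
  by rewrite preimage_cst; case: ifP.
have -> : (fun w => \sum_(1 <= s < t.+2) N s w)%N @^-1` B =
    \bigcup_h ((fun w => \sum_(1 <= s < t.+1) N s w)%N @^-1` [set h]
               `&` N t.+1 @^-1` [set k | B (h + k)%N]).
  have sumS w : (\sum_(1 <= s < t.+2) N s w =
      \sum_(1 <= s < t.+1) N s w + N t.+1 w)%N by rewrite big_nat_recr.
  apply/seteqP; split=> [w | w [h _ []]] /=; rewrite sumS.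
    by move=> Bw; exists (\sum_(1 <= s < t.+1) N s w)%N.
  by move=> ->.
apply: bigcup_measurable => h _; apply: measurableI; last by apply: mN; lia.
by apply: IHt => s C st; apply: mN; lia.
Qed.

(** * Additivity of versions of conditional probabilities *)

Section cond_prob_version_theory.
Context {d : measure_display} {Omega : measurableType d} {R : realType}.
Context (P : probability Omega R) (G : set_system Omega).
Hypothesis Gm : <<s G>> `<=` measurable.

Lemma cond_prob_version_measurable {B : set Omega} {q : Omega -> R} :
  cond_prob_version P <<s G>> B q ->
  measurable_fun [set: g_sigma_algebraType G] q.
Proof. by case=> mq _ _ _ C mC; rewrite setTI; exact: mq. Qed.

(** The event is the disjoint union of the fibres over [Q], and integrals are additive. This carries
    the conditional law of a draw from single points to arbitrary events. *)
Lemma cond_prob_version_fin (V : finType) (X : Omega -> V)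
    (q : V -> Omega -> R) (Q : pred V) :
  (forall v, measurable (X @^-1` [set v])) ->
  (forall v, cond_prob_version P <<s G>> (X @^-1` [set v]) (q v)) ->
  cond_prob_version P <<s G>> (X @^-1` [set v | Q v])
    (fun w => \sum_(v | Q v) q v w).
Proof.
move=> mX hq.
have mq v := cond_prob_version_measurable (hq v).
have iq v : P.-integrable [set: Omega] (fun w => (q v w)%:E) by case: (hq v).
have sumE w : (\sum_(v | Q v) q v w)%:E = (\sum_(v | Q v) (q v w)%:E)%E.
  by rewrite sumEFin.
split.
- move=> C mC.
  have := @measurable_sum _ (g_sigma_algebraType G) R setT _
    [seq v <- index_enum V | Q v] q mq measurableT C mC.
  rewrite setTI; congr (<<s G>> _).
  by apply/seteqP; split=> w /=; rewrite big_filter.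
- under eq_fun do rewrite sumE.
  by apply: integrable_sum.
- move=> A GA; have mA := Gm _ GA.
  under eq_integral do rewrite sumE.
  rewrite integral_sum//; last first.
    by move=> v; apply: integrableS (iq v).
  have -> : A `&` X @^-1` [set v | Q v] =
      \bigcup_(v in [set` Q]) (A `&` X @^-1` [set v]).
    apply/seteqP; split=> [w /= [Aw Qw] | w /= [v Qv [Aw Xw]]]; first by exists (X w).
    by split=> //; rewrite Xw.
  rewrite measure_fin_bigcup//.
  + rewrite -(@bigfs _ _ _ _ (index_enum V)) ?index_enum_uniq//.
      by apply: eq_bigr => v _; case: (hq v) => _ _ /(_ A GA).
    by move=> v _; rewrite mem_index_enum.
  + by move=> u v _ _ [w [[_ /= <-] [_ /= <-]]].
  + by move=> v _; exact: measurableI.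
Qed.

End cond_prob_version_theory.

(** * Pointwise bounds and measurability for the number of sample actions *)

Lemma resampling_index_cap (d M : nat) (v' : nat -> d.-tuple bool) (i : 'I_d) :
  (resampling_index M v' i <= M)%N.
Proof.
rewrite /resampling_index; elim/big_rec: _ => // k x _ xM.
exact: leq_trans (geq_minr _ _) xM.
Qed.

(** An integer [N] at most [M] equals the sum over m < M of 1[m < N], and m < N forces the copies 1
    to m to miss coordinate [i]. The index 0 is exempted because that slot is kept for the
    action. *)
Lemma resampling_index_le (d M : nat) (v' : nat -> d.-tuple bool) (i : 'I_d) :
  (resampling_index M v' i <=
   \sum_(m < M) [forall k : 'I_M.+1, (0 < k <= m) ==> ~~ tnth (v' k) i])%N.
Proof.
set N := resampling_index M v' i.
have NM : (N <= M)%N by exact: resampling_index_cap.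
have Nk (k : nat) : (1 <= k < M.+1)%N -> tnth (v' k) i -> (N <= k)%N.
  move=> kM vk; have : k \in index_iota 1 M.+1 by rewrite mem_index_iota.
  rewrite /N /resampling_index; elim: (index_iota _ _) => //= l s IHs.
  rewrite inE big_cons => /predU1P[<-|/IHs ks]; first by rewrite vk geq_minl.
  by case: ifP => // _; exact: leq_trans (geq_minr _ _) ks.
have -> : N = (\sum_(m < M) (m < N))%N.
  rewrite -(big_mkord xpredT (fun m => (m < N) : nat))%N (big_cat_nat (n := N))//=.
  rewrite [X in (_ + X)%N]big_nat_cond [X in (_ + X)%N]big1 ?addn0; last first.
    by move=> m /andP[/andP[Nm _] _]; rewrite ltnNge Nm.
  rewrite (eq_big_nat _ _ (F2 := fun=> 1%N)) ?sum_nat_const_nat ?subn0 ?muln1//.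
  by move=> m /= ->.
apply: leq_sum => m _; case: (ltnP m N) => // mN.
rewrite lt0b; apply/forallP => k; apply/implyP => /andP[k0 km].
apply/negP => vk; have := Nk k; rewrite k0 ltn_ord => /(_ isT vk) Nk'.
by have := leq_ltn_trans km (leq_trans mN Nk'); rewrite ltnn.
Qed.

Lemma sample_actions_cap (d M : nat) (v : d.-tuple bool)
    (v' : nat -> d.-tuple bool) : (sample_actions M v v' <= M)%N.
Proof.
apply/bigmax_leqP => j _; case: (tnth v j); last by rewrite mul0n.
by rewrite mul1n resampling_index_cap.
Qed.

(** By convexity, the exponential lies below its chord between 0 and 1. *)
Lemma expR_chord (R : realType) (x : R) :
  0 <= x <= 1 -> expR x <= 1 + (expR 1 - 1) * x.
Proof.
move=> /andP[x0 x1].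
have := @convex_expR R (Itv01 x0 x1) 1 0.
rewrite !convRE /= mulr1 mulr0 addr0 expR0 mulr1 => /le_trans; apply.
by rewrite /unstable.onem mulrBl mul1r mulrC addrCA.
Qed.

(* Coordinate [j] is to be resampled and the copies [1, ..., m] all miss it,
   as a constraint on the [k]-th draw, the action itself being the draw [0]. *)
Definition missed (d : nat) (j : 'I_d) (m k : nat) (u : d.-tuple bool) : bool :=
  if k == 0%N then tnth u j else (k <= m)%N ==> ~~ tnth u j.

(** A maximum of naturals is at most their sum. The factor V_j is absorbed as the constraint on draw
    0, which turns every summand into the indicator of an intersection over independent draws. *)
Lemma sample_actions_le (d M : nat) (v : d.-tuple bool)
    (v' : nat -> d.-tuple bool) :
  (sample_actions M v v' <=
   \sum_(j < d) \sum_(m < M)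
     [forall k : 'I_M.+1, missed d j m k (if k == 0%N :> nat then v else v' k)])%N.
Proof.
apply/bigmax_leqP => j _; rewrite (bigD1 j)//=; apply: leq_trans (leq_addr _ _).
case vj : (tnth v j); last by rewrite mul0n.
rewrite mul1n; apply: leq_trans (resampling_index_le _ _ _ _) _.
apply: leq_sum => m _; case: forallP => // miss; rewrite lt0b.
apply/forallP => k; rewrite /missed; case: eqP => // /eqP k0.
by have := miss k; rewrite lt0n k0.
Qed.

(** The count is a function of the finite family of draws 0 to [M]. The space is arbitrary, so this
    serves both the full sigma-algebra and the history. *)
Lemma measurable_sample_actions (disp : measure_display)
    (T : measurableType disp) (d M : nat) (V : T -> d.-tuple bool)
    (V' : nat -> T -> d.-tuple bool) (B : set nat) :
  (forall v, measurable (V @^-1` [set v])) ->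
  (forall k v, (1 <= k <= M)%N -> measurable (V' k @^-1` [set v])) ->
  measurable ((fun w => sample_actions M (V w) (fun k => V' k w)) @^-1` B).
Proof.
move=> mV mV'.
pose X (k : 'I_M.+1) w := if k == 0%N :> nat then V w else V' k w.
(* [inord k] has value [k] only for k <= M and defaults to 0 beyond; this is harmless, as only the
   copies 1 to [M] are read. *)
pose h (f : {ffun 'I_M.+1 -> d.-tuple bool}) :=
  sample_actions M (f ord0) (fun k => f (inord k)).
rewrite (_ : (fun w => _) = h \o (fun w => [ffun k => X k w])).
  rewrite comp_preimage; apply: measurable_finite_family => k v; rewrite /X; case: eqP => k0.
    exact: mV.
  by apply: mV'; have := ltn_ord k; lia.
apply/funext => w; rewrite /h /= /sample_actions ffunE /X /=.
apply: eq_bigr => j _; congr (_ * _)%N.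
rewrite /resampling_index big_nat_cond [RHS]big_nat_cond.
have inordE k : (1 <= k < M.+1)%N ->
    (if (inord k : 'I_M.+1) == 0%N :> nat then V w else V' (inord k : 'I_M.+1) w)
    = V' k w.
  by move=> /andP[k0 kM]; rewrite inordK// eqn0Ngt k0.
by apply: eq_bigl => k; case: (boolP (1 <= k < M.+1)%N) => //= kM; rewrite ffunE inordE.
Qed.

(** The sum telescopes to 1 - (1 - a)^M. *)
Lemma sum_geometric_le1 (R : realDomainType) (a : R) (M : nat) :
  0 <= a <= 1 -> \sum_(m < M) a * (1 - a) ^+ m <= 1.
Proof.
move=> /andP[a0 a1]; rewrite -mulr_sumr.
have := subrX1 (1 - a) M; rewrite addrAC subrr add0r mulNr.
move=> /(congr1 -%R); rewrite opprK opprB => <-.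
by rewrite gerBl exprn_ge0// subr_ge0.
Qed.

(** * Conditional mean of the number of sample actions in one round *)

Section conditional_expectation_of_sample_actions.
Context {disp : measure_display} {Omega : measurableType disp} {R : realType}.
Context (P : probability Omega R) (G : set_system Omega).
Hypothesis Gm : <<s G>> `<=` measurable.
Context (d M : nat) (V : Omega -> d.-tuple bool).
Context (V' : nat -> Omega -> d.-tuple bool) (p : Omega -> d.-tuple bool -> R).
Let X (k : 'I_M.+1) (w : Omega) := if k == 0%N :> nat then V w else V' k w.
Hypothesis mV : forall v, measurable (V @^-1` [set v]).
Hypothesis mV' :
  forall k v, (1 <= k <= M)%N -> measurable (V' k @^-1` [set v]).
Hypothesis p_ge0 : forall w v, 0 <= p w v.
Hypothesis p_sum1 : forall w, \sum_v p w v = 1.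
Hypothesis p_cond : forall k v,
  cond_prob_version P <<s G>> (X k @^-1` [set v]) (fun w => p w v).
Hypothesis X_indep : cond_independent P <<s G>> X.

Let mX k v : measurable (X k @^-1` [set v]).
Proof.
rewrite /X; case: eqP => k0; first exact: mV.
by apply: mV'; have := ltn_ord k; lia.
Qed.

(** The conditional probability that a draw has coordinate [j] equal to 1. *)
Let a (j : 'I_d) (w : Omega) := \sum_(v | tnth v j) p w v.

Let a_01 j w : 0 <= a j w <= 1.
Proof.
rewrite sumr_ge0//= -(p_sum1 w) [leRHS](bigID (fun v => tnth v j))/=.
by rewrite lerDl sumr_ge0.
Qed.

(** Draw 0 contributes [a j w], each of the draws 1 to [m] contributes [1 - a j w], and the
    remaining draws are unconstrained and contribute the total mass 1. *)
Let sum_missed j (m : 'I_M) w :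
  \prod_(k < M.+1) \sum_(v | missed d j m k v) p w v = a j w * (1 - a j w) ^+ m.
Proof.
rewrite big_ord_recl; congr (_ * _).
rewrite (eq_bigr (fun i : 'I_M => if (i < m)%N then 1 - a j w else 1)).
  rewrite -big_mkcond/= -(big_ord_widen M (fun=> 1 - a j w)) ?(ltnW (ltn_ord m))//.
  by rewrite prodr_const card_ord.
move=> i _; rewrite /missed /= /bump /=; case: ifP => /= im.
  by rewrite /a -(p_sum1 w) [in RHS](bigID (fun v => tnth v j))/= addrAC subrr add0r.
exact: p_sum1.
Qed.

Let E j m := \bigcap_k (X k @^-1` [set v | missed d j m k v]).

(** Conditional independence multiplies the conditional probabilities of the constraints on the
    individual draws. *)
Let E_cond j (m : 'I_M) :
  cond_prob_version P <<s G>> (E j m) (fun w => a j w * (1 - a j w) ^+ m).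
Proof.
rewrite (_ : (fun w => _) =
    fun w => \prod_(k < M.+1) \sum_(v | missed d j m k v) p w v); last first.
  by apply/funext => w; rewrite sum_missed.
apply: (X_indep (fun k => [set v | missed d j m k v])
  (fun k => measurable_bool_tuple d _)
  (fun k w => \sum_(v | missed d j m k v) p w v)) => k.
exact: cond_prob_version_fin.
Qed.

(** Summed over [m], the conditional probabilities form a geometric sum, at most 1 pointwise; it is
    then integrated over [A]. *)
Let sum_E_le j (A : set Omega) : <<s G>> A ->
  (\sum_(m < M) P (A `&` E j m) <= P A)%E.
Proof.
move=> GA; have mA := Gm _ GA.
have iE (m : 'I_M) : P.-integrable [set: Omega]
    (fun w => (a j w * (1 - a j w) ^+ m)%:E) by case: (E_cond j m).
have -> : (\sum_(m < M) P (A `&` E j m))%E =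
    (\int[P]_(w in A) (\sum_(m < M) a j w * (1 - a j w) ^+ m)%:E)%E.
  under eq_integral do rewrite -sumEFin.
  rewrite integral_sum//; last by move=> m; apply: integrableS (iE m).
  by apply: eq_bigr => m _; case: (E_cond j m) => _ _ /(_ A GA).
rewrite -[leRHS]mul1e -integral_cst//.
apply: ge0_le_integral => //.
- move=> w _; rewrite lee_fin sumr_ge0// => m _.
  have /andP[a0 a1] := a_01 j w.
  by rewrite mulr_ge0// exprn_ge0// subr_ge0.
- have miE (m : 'I_M) :
      measurable_fun A (EFin \o (fun w => a j w * (1 - a j w) ^+ m)).
    by apply: measurable_funTS; case/integrableP: (iE m).
  under eq_fun do rewrite -sumEFin.
  exact: emeasurable_sum.
- by move=> w _; rewrite lee_fin sum_geometric_le1.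
Qed.

(** This is E[S | G] <= d in integrated form. The whole space as [A] yields the bound on the mean;
    fibres of the past sum yield the exponential moment. *)
Lemma integral_sample_actions_le (A : set Omega) : <<s G>> A ->
  (\int[P]_(w in A) (sample_actions M (V w) (fun k => V' k w))%:R%:E <=
   d%:R%:E * P A)%E.
Proof.
move=> GA; have mA := Gm _ GA.
have mE j m : measurable (E j m).
  apply: fin_bigcap_measurable => [|k _]; first exact: finite_finset.
  have -> : X k @^-1` [set v | missed d j m k v] =
    \bigcup_(v in [set v | missed d j m k v]) (X k @^-1` [set v]).
    apply/seteqP; split=> [w /= Qw | w /= [v Qv Xw]]; first by exists (X k w).
    by rewrite Xw.
  by apply: fin_bigcup_measurable => //; exact: finite_finset.
apply: (@le_trans _ _ (\int[P]_(w in A)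
    (\sum_(j < d) \sum_(m < M) (\1_(E j m) w)%:E))%E).
  apply: ge0_le_integral => //.
  - apply/measurable_EFinP; apply: measurable_comp_nat => B.
    exact: measurable_sample_actions.
  - apply: emeasurable_sum => j; apply: emeasurable_sum => m.
    apply/measurable_EFinP.
    exact: measurable_indic.
  - move=> w _; under eq_bigr do rewrite sumEFin.
    rewrite sumEFin lee_fin.
    under eq_bigr => j _.
      under eq_bigr => m _.
        rewrite (_ : \1_(E j m) w =
          [forall k : 'I_M.+1, missed d j m k (X k w)]%:R); last first.
          rewrite indicE; congr (_ %:R); congr nat_of_bool.
          apply/idP/forallP => [|miss]; first by rewrite inE => Ew k; exact: Ew.
          by rewrite inE => k _; exact: miss.
        over.
      rewrite -natr_sum; over.
    by rewrite -natr_sum ler_nat sample_actions_le.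
have mE1 j m : measurable_fun A (EFin \o \1_(E j m) : Omega -> \bar R).
  apply/measurable_EFinP.
  exact: measurable_indic.
rewrite ge0_integral_sum//; last 2 first.
- by move=> j; apply: emeasurable_sum => m; exact: mE1.
- by move=> j w _; apply: sume_ge0 => m _; rewrite lee_fin.
apply: (@le_trans _ _ (\sum_(j < d) P A)%E); last first.
  rewrite -(fineK (fin_num_measure P A mA)) sumEFin -EFinM lee_fin.
  by rewrite sumr_const card_ord mulr_natl.
apply: lee_sum => j _; rewrite ge0_integral_sum//; last by move=> m; exact: mE1.
under eq_bigr do rewrite integral_indic// setIC.
exact: sum_E_le.
Qed.

End conditional_expectation_of_sample_actions.

(** * Exponential moment and upper tail of a sum of bounded integer variables *)

Section sum_tail.
Context {disp : measure_display} {Omega : measurableType disp} {R : realType}.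
Context (P : probability Omega R) (F : nat -> set_system Omega).
Context (T M d : nat) (N : nat -> Omega -> nat).
Hypothesis M_gt0 : (0 < M)%N.
Hypothesis N_le : forall s w, (N s w <= M)%N.
Hypothesis mN : forall s B, measurable (N s @^-1` B).
Let G (t : nat) (w : Omega) := (\sum_(1 <= s < t.+1) N s w)%N.
Hypothesis FG : forall t g, F t (G t @^-1` [set g]).
Hypothesis N_mean : forall t A, (t < T)%N -> F t A ->
  (\int[P]_(w in A) (N t.+1 w)%:R%:E <= d%:R%:E * P A)%E.

Let Z (t : nat) (w : Omega) : R := expR ((G t w)%:R / M%:R).

Let mG t B : measurable (G t @^-1` B).
Proof. by apply: measurable_sum_nat => s C _; exact: mN. Qed.

Let mZ t (A : set Omega) : measurable_fun A (EFin \o Z t).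
Proof.
apply/measurable_EFinP.
by apply: (@measurable_comp_nat _ _ _ _ (fun g => expR (g%:R / M%:R))) => B.
Qed.

Let Z_ge0 t w : (0 <= (Z t w)%:E)%E.
Proof. by rewrite lee_fin expR_ge0. Qed.

(** Bound on the factor by which the integral of [Z] grows in one round. *)
Let kappa : R := expR ((expR 1 - 1) * d%:R / M%:R).

Let e_ge1 : 0 <= (expR 1 - 1 : R).
Proof. by have := @expR_ge1Dx R 1; lra. Qed.

Let M_pos : 0 < M%:R :> R.
Proof. by rewrite ltr0n. Qed.

(* The past sum is integer valued, so conditioning on it amounts to integrating
   over its fibres, on each of which [Z t] is constant. *)
Let Z_step_fiber t (g : nat) : (t < T)%N ->
  (\int[P]_(w in G t @^-1` [set g]) (Z t.+1 w)%:E <=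
   kappa%:E * \int[P]_(w in G t @^-1` [set g]) (Z t w)%:E)%E.
Proof.
move=> tT; set A := G t @^-1` [set g].
have mA : measurable A by exact: mG.
have mh (h : nat -> R) : measurable_fun A (EFin \o (fun w => h (N t.+1 w))).
  by apply/measurable_EFinP; apply: measurable_comp_nat => B; exact: mN.
pose c : R := (expR 1 - 1) / M%:R.
have c0 : 0 <= c by rewrite divr_ge0// ltW.
pose z : R := expR (g%:R / M%:R).
have -> : (\int[P]_(w in A) (Z t w)%:E = z%:E * P A)%E.
  by rewrite -integral_cst//; apply: eq_integral => w; rewrite inE /= /Z => ->.
(* On [A], [Z t.+1] is [z] times exp(N/M), and the chord bound at N/M gives exp(N/M) <= 1 + c N. *)
apply: (@le_trans _ _
    (\int[P]_(w in A) (z * (1 + c * (N t.+1 w)%:R))%:E)%E).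
  apply: ge0_le_integral => //.
  - exact: mZ.
  - exact: (mh (fun n => z * (1 + c * n%:R))).
  - move=> w; rewrite lee_fin /A /= => Gw.
    rewrite /Z /G big_nat_recr//= -/(G t w) Gw natrD mulrDl expRD.
    apply: ler_wpM2l; first exact: expR_ge0.
    rewrite /c -mulrA [_^-1 * _]mulrC; apply: expR_chord.
    by rewrite divr_ge0//= ler_pdivrMr// mul1r ler_nat.
under eq_integral do rewrite EFinM.
rewrite ge0_integralZl_EFin//; last 3 first.
- by move=> w _; rewrite lee_fin addr_ge0// mulr_ge0.
- exact: (mh (fun n => 1 + c * n%:R)).
- exact: expR_ge0.
rewrite muleCA; apply: lee_wpmul2l; first by rewrite lee_fin expR_ge0.
under eq_integral do rewrite EFinD.
rewrite ge0_integralD//; last 2 first.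
- by move=> w _; rewrite lee_fin mulr_ge0.
- exact: (mh (fun n => c * n%:R)).
under [X in (_ + X)%E]eq_integral do rewrite EFinM.
rewrite integral_cst// mul1e ge0_integralZl_EFin//; last exact: (mh (fun n => n%:R)).
(* The fibre [A] is an event of the past, so the conditional mean bound applies on it. *)
apply: (@le_trans _ _ (P A + c%:E * (d%:R%:E * P A))%E).
  by apply/leeD2l/lee_wpmul2l => //; apply: N_mean => //; exact: FG.
rewrite muleA -[X in (X + _)%E]mul1e -ge0_muleDl//; last by rewrite -EFinM lee_fin mulr_ge0.
apply: lee_wpmul2r => //.
(* What remains is 1 + c d <= exp(c d), the right side being [kappa]. *)
rewrite -EFinM -EFinD lee_fin /kappa.
by rewrite (_ : _ * d%:R / M%:R = c * d%:R) ?expR_ge1Dx// /c mulrAC.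
Qed.

(** The fibres of [G t] form a countable partition of the space, over which the fibrewise bounds are
    summed. *)
Let Z_step t : (t < T)%N ->
  (\int[P]_w (Z t.+1 w)%:E <= kappa%:E * \int[P]_w (Z t w)%:E)%E.
Proof.
move=> tT.
have <- : \bigcup_g (G t @^-1` [set g]) = [set: Omega].
  by apply/seteqP; split=> // w _; exists (G t w).
have tG : trivIset [set: nat] (fun g => G t @^-1` [set g]).
  by move=> g h _ _ [w [/= <- <-]].
rewrite !ge0_integral_bigcup//; try exact: mZ.
rewrite -nneseriesZl//; last by move=> g _; apply: integral_ge0.
apply: lee_nneseries => [g *|g *]; first by apply: integral_ge0 => *; exact: Z_ge0.
exact: Z_step_fiber.
Qed.

Lemma integral_expR_sum_le t : (t <= T)%N ->
  (\int[P]_w (expR ((G t w)%:R / M%:R))%:E <= (kappa ^+ t)%:E)%E.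
Proof.
elim: t => [|t IHt] tT.
  rewrite (eq_integral (cst 1%E)).
    by rewrite integral_cst// mul1e expr0; exact: probability_le1.
  by move=> w _; rewrite /G big_geq// mul0r expR0.
apply: le_trans (Z_step t tT) _; rewrite exprS EFinM.
by apply: lee_wpmul2l; [rewrite lee_fin expR_ge0 | exact: IHt (ltnW tT)].
Qed.

(** Markov's inequality for exp(G/M), applied to the complementary event. *)
Lemma sum_tail_le (delta : R) : 0 < delta ->
  ((1 - delta)%:E <=
   P [set w | (\sum_(1 <= t < T.+1) (N t w)%:R <=
               (expR 1 - 1) * d%:R * T%:R + M%:R * ln (1 / delta))%R])%E.
Proof.
move=> delta0; set c := _ + M%:R * _; set B := [set w | _].
have BE : B = G T @^-1` [set g | g%:R <= c].
  by apply/seteqP; split=> w; rewrite /B /= natr_sum.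
have mB : measurable B by rewrite BE; exact: mG.
suff : (P (~` B) <= delta%:E)%E.
  rewrite -[X in _ -> (_ <= P X)%E]setCK [X in _ -> (_ <= X)%E]probability_setC.
    by rewrite EFinB => ?; rewrite leeB.
  exact: measurableC.
(* The threshold [c] is the solution of exp(-c/M) kappa^T = delta. *)
have -> : delta = expR (- c / M%:R) * kappa ^+ T.
  rewrite -expRM_natl -expRD -[LHS](lnK delta0); congr expR.
  by rewrite /c div1r lnV//; field; rewrite gt_eqF.
rewrite -[leLHS]mul1e -integral_cst//; last exact: measurableC.
have mZc : measurable_fun [set: Omega]
    (fun w => (expR (- c / M%:R))%:E * (Z T w)%:E)%E.
  apply/measurable_EFinP.
  by apply: (@measurable_comp_nat _ _ _ _
    (fun g => expR (- c / M%:R) * expR (g%:R / M%:R))) => C.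
(* Outside [B] the sum exceeds [c], so exp((G - c)/M) is at least 1 there. *)
apply: (@le_trans _ _ (\int[P]_(w in ~` B) ((expR (- c / M%:R))%:E * (Z T w)%:E))%E).
  apply: ge0_le_integral => //; first exact: measurableC.
    exact: measurable_funTS.
  move=> w /=; rewrite /B /= -natr_sum -/(G T w) => /negP; rewrite -ltNge => Gc.
  rewrite -EFinM lee_fin /Z -expRD -[leLHS]expR0 ler_expR -mulrDl.
  by apply: divr_ge0; [rewrite addrC subr_ge0 ltW | exact: ltW].
apply: (@le_trans _ _ (\int[P]_w ((expR (- c / M%:R))%:E * (Z T w)%:E))%E).
  apply: ge0_subset_integral => //; first exact: measurableC.
  by move=> w _; rewrite -EFinM lee_fin mulr_ge0 ?expR_ge0.
rewrite ge0_integralZl_EFin ?expR_ge0//; last exact: mZ.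
rewrite EFinM; apply: lee_wpmul2l; first by rewrite lee_fin expR_ge0.
exact: integral_expR_sum_le.
Qed.

End sum_tail.

(** * The history of the interaction, and the two bounds for Geometric Resampling *)

Lemma history_measurable (d0 dE : measure_display) (Omega : measurableType d0)
    (R : realType) (P : probability Omega R)
    (d M : nat) (E : nat -> measurableType dE) (Y : forall s : nat, {RV P >-> E s})
    (V : nat -> {RV P >-> d.-tuple bool})
    (V' : nat -> nat -> {RV P >-> d.-tuple bool}) (t : nat) :
  history M Y V V' t `<=` measurable.
Proof.
apply: smallest_sub; first exact: sigma_algebra_measurable.
move=> _ [[s _ [B mB <-]]|[s _ [[B mB <-]|[k _ [B mB <-]]]]]; exact: measurable_funP.
Qed.

Theorem proposition3 (R : realType) (d0 dE : measure_display)
    (Omega : measurableType d0) (P : probability Omega R)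
    (d T M : nat) (S : {set d.-tuple bool})
    (E : nat -> measurableType dE) (Y : forall s : nat, {RV P >-> E s})
    (V : nat -> {RV P >-> d.-tuple bool})
    (V' : nat -> nat -> {RV P >-> d.-tuple bool})
    (p : nat -> Omega -> d.-tuple bool -> R)
    (F := fun t : nat => history M Y V V' t)
    (St := fun (t : nat) (w : Omega) =>
       sample_actions M (V t w) (fun k => V' t k w)) :
  S != finset.set0 -> (1 <= T)%N -> (1 <= M)%N ->
  (forall t w, (1 <= t <= T)%N -> V t w \in S) ->
  (forall t w, (1 <= t <= T)%N -> distribution_on S (p t w)) ->
  (forall t v, (1 <= t <= T)%N ->
     forall C : set R, measurable C -> F t.-1 ((fun w => p t w v) @^-1` C)) ->
  (forall t v, (1 <= t <= T)%N ->
     cond_prob_version P (F t.-1) (V t @^-1` [set v]) (fun w => p t w v)) ->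
  (forall t k v, (1 <= t <= T)%N -> (1 <= k <= M)%N ->
     cond_prob_version P (F t.-1) (V' t k @^-1` [set v]) (fun w => p t w v)) ->
  (forall t, (1 <= t <= T)%N ->
     cond_independent P (F t.-1)
       (fun (k : 'I_M.+1) (w : Omega) =>
          if (k : nat) == 0%N then V t w else V' t k w)) ->
  (forall t, (1 <= t <= T)%N ->
     ('E_P[fun w => (St t w)%:R] <= d%:R%:E)%E) /\
  (forall delta : R, 0 < delta ->
     ((1 - delta)%:E <=
      P [set w | (\sum_(1 <= t < T.+1) (St t w)%:R <=
                  (expR 1 - 1) * d%:R * T%:R + M%:R * ln (1 / delta))%R])%E).
Proof.
move=> _ _ M0 _ pS _ pV pV' indep.
have mF t : F t `<=` measurable by exact: history_measurable.
have mV t v : measurable (V t @^-1` [set v]).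
  rewrite -[X in measurable X]setTI; apply: measurable_funP => //.
  exact: measurable_bool_tuple.
have mV' t k v : measurable (V' t k @^-1` [set v]).
  rewrite -[X in measurable X]setTI; apply: measurable_funP => //.
  exact: measurable_bool_tuple.
have mean t A : (1 <= t <= T)%N -> F t.-1 A ->
    (\int[P]_(w in A) (St t w)%:R%:E <= d%:R%:E * P A)%E.
  move=> tT FA; apply: (integral_sample_actions_le P _ (mF t.-1) d M (V t)
    (V' t) (p t)) => //.
  - by move=> w v; case: (pS t w tT).
  - by move=> w; case: (pS t w tT).
  - move=> k v; case: (eqVneq (k : nat) 0%N) => k0.
      exact: pV.
    by apply: pV' => //; have := ltn_ord k; lia.
  - exact: indep.
have F_draw t s v : (1 <= s <= t)%N -> F t (V s @^-1` [set v]).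
  move=> st; apply: sub_sigma_algebra; right; exists s => //; left.
  by exists [set v]; [exact: measurable_bool_tuple | rewrite setTI].
have F_copy t s k v : (1 <= s <= t)%N -> (1 <= k <= M)%N ->
    F t (V' s k @^-1` [set v]).
  move=> st kM; apply: sub_sigma_algebra; right; exists s => //; right.
  exists k => //.
  by exists [set v]; [exact: measurable_bool_tuple | rewrite setTI].
split=> [t tT|].
  rewrite unlock; apply: le_trans (mean t setT tT _) _.
    exact: (@measurableT _ (g_sigma_algebraType _)).
  by rewrite probability_setT mule1.
move=> delta.
apply: (sum_tail_le P F T M d St M0).
- by move=> s w; exact: sample_actions_cap.
- by move=> s B; exact: measurable_sample_actions.
(* The past sum must be measurable for the history itself: the measurability lemmas are reused with
   the history as the sigma-algebra, every draw up to round [t] belonging to it. *)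
- move=> t g; rewrite /F /history.
  apply: (@measurable_sum_nat _ (g_sigma_algebraType _)) => s C st.
  apply: (@measurable_sample_actions _ (g_sigma_algebraType _)).
    by move=> v; exact: F_draw.
  by move=> k v kM; exact: F_copy.
- by move=> t A tT FA; exact: (mean t.+1).
Qed.
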